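(* Let $d\in\mathbb{N}_+$, let $f:[0,1]^d\to\mathbb{R}$ be a function, and let $\omega:[0,d]\to[0,\infty)$ be a modulus of regularity of $f$. Then, for any $n\in\mathbb{N}_+$, there exists a ReLU MLP $\Phi$ (with input in $\mathbb{R}^d$ and real output, considered on $[0,1]^d$) with width at most $8d(n+1)^d$, depth at most $\lceil\log_2 d\rceil+4$, and at most $16d(n+1)^d$ nonzero parameters, which satisfies $$\|f-\Phi\|_{L^\infty([0,1]^d)}\le\omega\left(\frac{d}{2n}\right)$$ and $$f(\mathbf{x})=\Phi(\mathbf{x})\quad\text{for all }\mathbf{x}\in\left\{\tfrac0n,\tfrac1n,\dots,\tfrac nn\right\}^d.$$ Furthermore, $\omega$ is a modulus of regularity of $\Phi$ on $[0,1]^d$.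
   Context: Modulus of regularity: for $I=[0,\infty)$ or $I=[0,T]$ with $T\ge0$, a function $\omega:I\to[0,\infty)$ is called a modulus of regularity if $\omega(0)=0$, $\omega$ is monotone increasing (not necessarily strictly), and $\omega$ is concave (it need not be continuous at $0$). It is a modulus of regularity of a function $g$ on $X\subseteq\mathbb{R}^d$ if $|g(\mathbf{x})-g(\mathbf{y})|\le\omega(\|\mathbf{x}-\mathbf{y}\|_1)$ for all $\mathbf{x},\mathbf{y}\in X$, where $\|\cdot\|_1$ is the $\ell^1$ norm. $\|g\|_{L^\infty(\Omega)}=\inf\{C\ge0:|g|\le C\text{ almost everywhere on }\Omega\}$. ReLU MLP: a function $\Phi:\mathbb{R}^{d_1}\to\mathbb{R}^{d_{\Delta+1}}$ with a representation $\mathbf{x}^{(1)}=\mathbf{x}$, $\mathbf{x}^{(l+1)}=\operatorname{ReLU}(\mathbf{W}^{(l)}\mathbf{x}^{(l)}+\mathbf{b}^{(l)})$ for $l=1,\dots,\Delta-1$ (ReLU$(t)=\max\{0,t\}$ applied componentwise), $\Phi(\mathbf{x})=\mathbf{W}^{(\Delta)}\mathbf{x}^{(\Delta)}+\mathbf{b}^{(\Delta)}$, where $\mathbf{W}^{(l)}\in\mathbb{R}^{d_{l+1}\times d_l}$ and $\mathbf{b}^{(l)}\in\mathbb{R}^{d_{l+1}}$. Its depth is $\Delta-1$ (number of hidden layers), its width is $\max_{2\le l\le\Delta}d_l$, and the number of nonzero parameters is the total number of nonzero entries of all $\mathbf{W}^{(l)},\mathbf{b}^{(l)}$. *)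

(* Defs.v *)
From HB Require Import structures.
From mathcomp Require Import all_boot all_order all_algebra.
From mathcomp Require Import all_classical all_reals all_analysis.

Set Implicit Arguments.
Unset Strict Implicit.
Unset Printing Implicit Defensive.

Import Order.TTheory GRing.Theory Num.Theory.
Import numFieldNormedType.Exports.

Local Open Scope classical_set_scope.
Local Open Scope ring_scope.

(* Points of R^d are d-tuples of reals, because the library equips tuples with
   the product sigma-algebra. The library has no Lebesgue measure on R^d; it is
   built here as the iterated product of [lebesgue_measure], transported along
   (x, t) |-> x :: t. *)

Section lebesgue_tuple.
Variable R : realType.
Local Notation borelR := (measurableTypeR R).

Definition tuple_cons n (p : borelR * n.-tuple borelR) : n.+1.-tuple borelR :=
  [tuple of p.1 :: p.2].

Definition tuple_uncons n (t : n.+1.-tuple borelR) : borelR * n.-tuple borelR :=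
  (thead t, [tuple of behead t]).

Lemma tuple_consK n : cancel (@tuple_cons n) (@tuple_uncons n).
Proof.
by case=> x t; congr pair => //=; apply/val_inj.
Qed.

Lemma measurable_tuple_cons n :
  measurable_fun [set: borelR * n.-tuple borelR] (@tuple_cons n).
Proof. exact: measurable_cons. Qed.

Lemma measurable_tuple_uncons n :
  measurable_fun [set: n.+1.-tuple borelR] (@tuple_uncons n).
Proof.
apply/measurable_fun_pairP; split; first exact: measurable_tnth.
exact: measurable_behead.
Qed.

Section step.
Variable n : nat.
Variable mu : {sigma_finite_measure set (n.-tuple borelR) -> \bar R}.

Definition lebesgue_tuple_step : set (n.+1.-tuple borelR) -> \bar R :=
  pushforward (@lebesgue_measure R \x mu)%E (@tuple_cons n).

Let step0 : (lebesgue_tuple_step set0 = 0)%E.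
Proof. by rewrite /lebesgue_tuple_step /pushforward preimage_set0 measure0. Qed.

Let step_ge0 A : (0 <= lebesgue_tuple_step A)%E.
Proof.
by rewrite /lebesgue_tuple_step /pushforward; apply: measure_ge0.
Qed.

Let step_sigma_additive : semi_sigma_additive lebesgue_tuple_step.
Proof.
move=> F mF tF mUF; rewrite /lebesgue_tuple_step /pushforward preimage_bigcup.
apply: measure_semi_sigma_additive.
- by move=> k; rewrite -[X in measurable X]setTI; exact: measurable_tuple_cons.
- apply/trivIsetP => /= i j _ _ ij; rewrite -preimage_setI.
  by move/trivIsetP : tF => /(_ _ _ _ _ ij) ->//; rewrite preimage_set0.
- rewrite -preimage_bigcup -[X in measurable X]setTI.
  exact: measurable_tuple_cons.
Qed.

HB.instance Definition _ := isMeasure.Build _ _ _ lebesgue_tuple_step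
  step0 step_ge0 step_sigma_additive.

Let step_sigma_finite : sigma_finite setT lebesgue_tuple_step.
Proof.
have /sigma_finiteP[F [TF ndF Foo]] := sigma_finiteT (@lebesgue_measure R).
have /sigma_finiteP[G [TG ndG Goo]] := sigma_finiteT mu.
exists (fun k => @tuple_uncons n @^-1` (F k `*` G k)).
  apply/esym; rewrite -preimage_bigcup -subTset => t _ /=.
  have [i _ Fi] : (\bigcup_k F k) (tuple_uncons t).1 by rewrite -TF.
  have [j _ Gj] : (\bigcup_k G k) (tuple_uncons t).2 by rewrite -TG.
  exists (maxn i j) => //; split.
    by move: Fi; exact/subsetPset/ndF/leq_maxl.
  by move: Gj; exact/subsetPset/ndG/leq_maxr.
move=> k; have [? ?] := Foo k; have [? ?] := Goo k; split.
  rewrite -[X in measurable X]setTI.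
  by apply: (@measurable_tuple_uncons n measurableT); exact: measurableX.
rewrite /lebesgue_tuple_step /pushforward -comp_preimage.
rewrite (_ : @tuple_uncons n \o @tuple_cons n = id); last first.
  by apply/funext => p; exact: tuple_consK.
by rewrite preimage_id product_measure1E// lte_mul_pinfty// ge0_fin_numE.
Qed.

HB.instance Definition _ := Measure_isSigmaFinite.Build _ _ _
  lebesgue_tuple_step step_sigma_finite.

End step.

Fixpoint lebesgue_tuple n :
    {sigma_finite_measure set (n.-tuple borelR) -> \bar R} :=
  match n with
  | 0 => \d_ [tuple]
  | n'.+1 => lebesgue_tuple_step (lebesgue_tuple n')
  end.

Lemma lebesgue_tuple_box n (A : 'I_n -> set borelR) :
    (forall i, measurable (A i)) ->
  lebesgue_tuple n [set x | forall i, A i (tnth x i)] =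
  (\prod_(i < n) lebesgue_measure (A i))%E.
Proof.
elim: n A => [|n IH] A mA.
  by rewrite big_ord0 /= diracE mem_set//= => -[].
rewrite big_ord_recl -(IH (fun i => A (lift ord0 i)))// -product_measure1E//.
  congr ((_ \x _)%E _); apply/seteqP; split=> [[x t] /= At|[x t] /= [Ax At] i].
    split=> [|i]; first exact: (At ord0).
    by have := At (lift ord0 i); rewrite tnthS.
  by case: (unliftP ord0 i) => [j|] ->; rewrite ?tnthS.
rewrite [X in measurable X](_ : _ = \bigcap_(i in [set: 'I_n])
    ((fun t : n.-tuple borelR => tnth t i) @^-1` A (lift ord0 i))).
  apply: fin_bigcap_measurable => [|i _]; first exact: finite_finset.
  by rewrite -[X in measurable X]setTI; exact: measurable_tnth.
by apply/seteqP; split=> t /= At i; [move=> _; exact: At|exact: (At i I)].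
Qed.

End lebesgue_tuple.

Section Linfty.
Variables (R : realType) (d : nat).

(* Extended-real valued, so that the norm of a function with no essential bound
   is +oo. *)
Definition Linfty_norm (Omega : set (d.-tuple R)) (g : d.-tuple R -> R) :
    \bar R :=
  ereal_inf [set C%:E | C in [set C : R | 0 <= C /\
    {ae lebesgue_tuple R d, forall x, Omega x -> `|g x| <= C}]].

Definition unit_cube : set (d.-tuple R) :=
  [set x | forall i, 0 <= tnth x i <= 1].

Definition unit_grid (n : nat) : set (d.-tuple R) :=
  [set x | forall i, exists2 k : nat, (k <= n)%N & tnth x i = k%:R / n%:R].

Definition l1_dist (x y : d.-tuple R) : R :=
  \sum_(i < d) `|tnth x i - tnth y i|.

End Linfty.

Arguments unit_cube : clear implicits.

Section modulus.
Variable R : realType.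

Definition concave_on (I : interval R) (w : R -> R) : Prop :=
  {in I &, forall x y (t : R), 0 <= t <= 1 ->
    t * w x + (1 - t) * w y <= w (t * x + (1 - t) * y)}.

Definition modulus_of_regularity (I : interval R) (w : R -> R) : Prop :=
  [/\ {in I, forall x, 0 <= w x},
      w 0 = 0,
      {in I &, {homo w : x y / x <= y}} &
      concave_on I w].

Definition modulus_of_regularity_of (I : interval R) (w : R -> R) (d : nat)
    (X : set (d.-tuple R)) (g : d.-tuple R -> R) : Prop :=
  modulus_of_regularity I w /\
  {in X &, forall x y, `|g x - g y| <= w (l1_dist x y)}.

End modulus.

Section mlp.
Variable R : realType.

(* [mlp p m] is a representation (W^(1), b^(1)), ..., (W^(Delta), b^(Delta))
   with input dimension m and output dimension p, listed from the input side: each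
   [Hidden] is an affine map followed by ReLU, and [Output] is the final affine
   map without ReLU. *)
Inductive mlp (p m : nat) : Type :=
| Output of 'M[R]_(p, m) & 'cV[R]_p
| Hidden (k : nat) of (0 < k)%N & 'M[R]_(k, m) & 'cV[R]_k & mlp p k.

Definition relu k (v : 'cV[R]_k) : 'cV[R]_k := map_mx (Num.max 0) v.

Fixpoint mlp_eval p m (N : mlp p m) : 'cV[R]_m -> 'cV[R]_p :=
  match N with
  | Output W b => fun x => W *m x + b
  | Hidden k _ W b N' => fun x => mlp_eval N' (relu (W *m x + b))
  end.

Definition mlp_fun m (N : mlp 1 m) (x : m.-tuple R) : R :=
  mlp_eval N (\col_i tnth x i) ord0 ord0.

Fixpoint mlp_depth p m (N : mlp p m) : nat :=
  match N with
  | Output _ _ => 0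
  | Hidden _ _ _ _ N' => (mlp_depth N').+1
  end.

Fixpoint mlp_width p m (N : mlp p m) : nat :=
  match N with
  | Output _ _ => 0
  | Hidden k _ _ _ N' => maxn k (mlp_width N')
  end.

Definition nnz k l (A : 'M[R]_(k, l)) : nat := #|[pred ij | A ij.1 ij.2 != 0]|.

Fixpoint mlp_params p m (N : mlp p m) : nat :=
  match N with
  | Output W b => nnz W + nnz b
  | Hidden _ _ W b N' => nnz W + nnz b + mlp_params N'
  end.

End mlp.

(* Main.v *)
Require Import Defs.
From mathcomp Require Import all_boot all_order all_algebra.
From mathcomp Require Import all_classical all_reals all_analysis.
From mathcomp Require Import ring lra zify.

(* The network is the piecewise linear interpolant of f on the Kuhn
   triangulation of the grid, the sum over the nodes y / n of f (y / n) times the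
   hat function
     relu (1 - max_i relu (n x_i - y_i) - max_i relu (y_i - n x_i)).
   This hat function is the probability that floor (n x_i + theta) = y_i for all
   i, with theta uniform in [0, 1). Hence the interpolant at x is the
   expectation of f at the randomly rounded point X = floor (n x + theta) / n.
   Rounding two points with the same theta preserves their order in each
   coordinate, so the expected l1 distance of the rounded points is that of the
   original ones, and Jensen's inequality for the concave modulus transfers it
   to the interpolant. The error bound is Jensen again, as
   E |x_i - X_i| = 2 q (1 - q) / n <= 1 / (2 n), where q is the fractional part
   of n x_i. *)

Set Implicit Arguments.
Unset Strict Implicit.
Unset Printing Implicit Defensive.

Import Order.TTheory GRing.Theory Num.Theory.

Local Open Scope ring_scope.

(** * Networks with neurons indexed by finite types *)

Section realizes.
Variable R : realType.

(* Neurons are indexed by an arbitrary finite type, so that a family of parallel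
   subnetworks is a product of index types. Only nonnegative inputs are
   considered: this is what makes relu the identity on them. *)
Definition realizes (I : finType) (F : (I -> R) -> R) (wd dp np : nat) : Prop :=
  forall m (e : 'I_m -> I), bijective e ->
  exists N : mlp R 1 m,
    [/\ (mlp_width N <= wd)%N, (mlp_depth N <= dp)%N, (mlp_params N <= np)%N &
      forall v, (forall i, 0 <= v i) ->
        mlp_eval N (\col_i v (e i)) ord0 ord0 = F v].

Lemma realizes_le (I : finType) (F F' : (I -> R) -> R)
    (wd wd' dp dp' np np' : nat) :
  realizes F wd dp np -> (forall v, (forall i, 0 <= v i) -> F v = F' v) ->
  (wd <= wd')%N -> (dp <= dp')%N -> (np <= np')%N ->
  realizes F' wd' dp' np'.
Proof.
move=> rF FF' lew led lep m e be; have [N [Nw Nd Np NF]] := rF m e be.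
exists N; split; [exact: leq_trans lew|exact: leq_trans led|
  exact: leq_trans lep|by move=> v v0; rewrite NF// FF'].
Qed.

(** Sparsity is certified by a map hitting every nonzero position, so parameter counts become
    cardinalities of index types. *)
Lemma nnz_le_card k l (A : 'M[R]_(k, l)) (T : finType) (h : T -> 'I_k * 'I_l) :
  (forall i j, A i j != 0 -> exists t, h t = (i, j)) -> (nnz A <= #|T|)%N.
Proof.
move=> hA; apply: leq_trans (leq_image_card h T).
apply/subset_leq_card/fintype.subsetP => -[i j] /hA[t ht].
by apply/fintype.imageP; exists t.
Qed.

Lemma realizes_output (I : finType) (a : I -> R) :
  realizes (fun v => \sum_i a i * v i) 0 0 #|I|.
Proof.
move=> m e [g eK gK]; exists (Output (\row_i a (e i)) 0); split=> //=.
- have -> : nnz (0 : 'cV[R]_1) = 0%N.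
    by rewrite /nnz eq_card0// => -[i j]; rewrite !inE mxE eqxx.
  rewrite addn0; apply: (@nnz_le_card _ _ _ _ (fun i => (ord0, g i))) => i j _.
  by exists (e j); rewrite eK (ord1 i).
- move=> v _; rewrite !mxE addr0 (reindex e)/=; last by exists g => i _.
  by apply: eq_bigr => i _; rewrite !mxE.
Qed.

(** Prepends one layer, with [h] and [h'] covering the supports of [W] and [b]. The layers compose
    because relu outputs are nonnegative, as [realizes] asks of inputs. *)
Lemma realizes_hidden (I J T T' : finType) (W : J -> I -> R) (b : J -> R)
    (h : T -> J * I) (h' : T' -> J) (F : (J -> R) -> R) (wd dp np : nat) :
  (0 < #|J|)%N ->
  (forall j i, W j i != 0 -> exists t, h t = (j, i)) ->
  (forall j, b j != 0 -> exists t, h' t = j) ->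
  realizes F wd dp np ->
  realizes (fun v => F (fun j => Num.max 0 (\sum_i W j i * v i + b j)))
    (maxn #|J| wd) dp.+1 (#|T| + #|T'| + np).
Proof.
move=> J0 hW hb rF m e [g eK gK].
have [N [Nw Nd Np NF]] := rF _ _ (enum_val_bij J).
exists (Hidden J0 (\matrix_(j, i) W (enum_val j) (e i))
               (\col_j b (enum_val j)) N); split=> //=.
- by rewrite geq_max leq_maxl leq_max Nw orbT.
- rewrite !leq_add//.
  + apply: (@nnz_le_card _ _ _ _ (fun t => (enum_rank (h t).1, g (h t).2))).
    move=> j i; rewrite mxE => /hW[t ht]; exists t.
    by rewrite ht/= enum_valK eK.
  + apply: (@nnz_le_card _ _ _ _ (fun t => (enum_rank (h' t), ord0))).
    move=> j i; rewrite mxE => /hb[t ht]; exists t.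
    by rewrite ht/= enum_valK (ord1 i).
- move=> v v0; rewrite -NF; last by move=> j; rewrite le_max lexx.
  congr (mlp_eval N _ _ _); apply/colP => j; rewrite !mxE.
  congr (Num.max 0 (_ + _)).
  rewrite [RHS](reindex e)/=; last by exists g => i _.
  by apply: eq_bigr => i _; rewrite !mxE.
Qed.

End realizes.

(** * Maxima and hat functions *)

Section max_tree.
Variable R : realType.

(** [U] pads [u] by zeros, so that for odd [m] the last entry is paired with 0; this is harmless as
    all values are nonnegative. *)
Lemma bigmax_pairs (m : nat) (u : 'I_m -> R) (U : nat -> R) :
  (forall i : 'I_m, u i = U i) -> (forall k, 0 <= U k) ->
  (forall k, (m <= k)%N -> U k = 0) ->
  \big[Num.max/0]_(j < uphalf m) Num.max (U j.*2) (U j.*2.+1) =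
  \big[Num.max/0]_(i < m) u i.
Proof.
move=> uU U0 Um; apply/le_anti/andP; split.
  have Ule k : U k <= \big[Num.max/0]_(i < m) u i.
    have [km|mk] := ltnP k m; first by rewrite -(uU (Ordinal km)) le_bigmax.
    by rewrite Um//; exact: bigmax_ge_id.
  apply: bigmax_le => [|j _]; first exact: bigmax_ge_id.
  by rewrite ge_max !Ule.
apply: bigmax_le => [|i _]; first exact: bigmax_ge_id.
have im : (i./2 < uphalf m)%N.
  by rewrite gtn_uphalf_double; have := ltn_ord i; lia.
apply: le_trans (le_bigmax _ _ (Ordinal im)) => /=.
rewrite uU le_max -[in U i](odd_double_half i).
by case: (odd i); rewrite ?add0n ?add1n lexx ?orbT.
Qed.

(** The weight ignores the index in [C], so every neuron first adds up the pieces of an item. *)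
Definition halve_weight (G C : finType) m
    (q : G * 'I_(uphalf m) * bool) (p : G * 'I_m * C) : R :=
  (p.1.1 == q.1.1)%:R *
  (if q.2 then (p.1.2 == q.1.2.*2 :> nat)%:R - (p.1.2 == q.1.2.*2.+1 :> nat)%:R
   else (p.1.2 == q.1.2.*2.+1 :> nat)%:R).

(* The maximum of nonnegative a and b is stored as the pair of neurons
   relu (a - b) and relu b, whose sum it is. *)
Lemma realizes_halve (G C : finType) (H : (G -> R) -> R) (m wd dp np : nat) :
  (0 < #|G|)%N -> (0 < m)%N ->
  realizes (fun v : G * 'I_(uphalf m) * bool -> R =>
    H (fun g => \big[Num.max/0]_j \sum_b v (g, j, b))) wd dp np ->
  realizes (fun v : G * 'I_m * C -> R =>
    H (fun g => \big[Num.max/0]_i \sum_c v (g, i, c)))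
    (maxn (#|G| * uphalf m * 2) wd) dp.+1
    (#|G| * (m + m./2) * #|C| + np).
Proof.
move=> G0 m0 rH.
have half_lt (i : 'I_m) : (i./2 < uphalf m)%N.
  by rewrite gtn_uphalf_double; have := ltn_ord i; lia.
have uphalf_lt (j : 'I_(m./2)) : (j < uphalf m)%N.
  by have := ltn_ord j; rewrite uphalf_half; lia.
have odd_lt (j : 'I_(m./2)) : (j.*2.+1 < m)%N by have := ltn_ord j; lia.
(* Every item feeds the [true] neuron of its pair, and odd items also feed the [false] one:
   [m + m./2] connections for each group and each element of [C]. *)
pose h (t : (G * 'I_m * C) + (G * 'I_(m./2) * C)) :
    (G * 'I_(uphalf m) * bool) * (G * 'I_m * C) :=
  match t with
  | inl (g, i, c) => ((g, Ordinal (half_lt i), true), (g, i, c))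
  | inr (g, j, c) =>
      ((g, Ordinal (uphalf_lt j), false), (g, Ordinal (odd_lt j), c))
  end.
have halve_cover q p :
    @halve_weight G C m q p != 0 -> exists t, h t = (q, p).
  case: q p => [[g j] b] [[g' i] c]; rewrite /halve_weight/=.
  have [->|_] := eqVneq g' g; last by rewrite mul0r eqxx.
  rewrite mul1r; case: b => [Wn|].
    exists (inl (g, i, c)); congr (_, _, _, _); apply/val_inj => /=.
    move: Wn; have [->|_] := eqVneq (i : nat) j.*2; first by rewrite doubleK.
    have [->|_] := eqVneq (i : nat) j.*2.+1; first by lia.
    by rewrite subrr eqxx.
  have [ij|_] := eqVneq (i : nat) j.*2.+1; last by rewrite eqxx.
  move=> _; have jm : (j < m./2)%N by have := ltn_ord i; lia.
  exists (inr (g, Ordinal jm, c)); rewrite /h.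
  by congr (_, _, _, (_, _, _)); apply/val_inj.
have J0 : (0 < #|{: G * 'I_(uphalf m) * bool}|)%N.
  by rewrite !card_prod card_ord card_bool !muln_gt0 G0 uphalf_gt0 m0.
have bias0 (q : G * 'I_(uphalf m) * bool) : 0 != 0 :> R ->
    exists t : void, match t with end = q by rewrite eqxx.
have := realizes_hidden J0 halve_cover bias0 rH.
rewrite !(card_sum, card_prod, card_ord, card_bool, card_void) addn0.
move=> rF; apply: (realizes_le rF) => //; last first.
  by rewrite -!mulnA -mulnDr -mulnDl leqnn.
move=> v v0; congr (H _); apply/funext => g.
pose U k := \sum_(p : G * 'I_m * C | (p.1.1 == g) && (p.1.2 == k :> nat)) v p.
have U0 k : 0 <= U k by apply: sumr_ge0 => p _.
rewrite -[RHS](@bigmax_pairs _ _ U)//.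
- have UE k : \sum_(p : G * 'I_m * C)
      (p.1.1 == g)%:R * (p.1.2 == k :> nat)%:R * v p = U k.
    rewrite /U [RHS]big_mkcond; apply: eq_bigr => p _.
    by case: (_ == g); case: (_ == k); rewrite ?(mul0r, mul1r).
  apply: eq_bigr => j _; rewrite big_bool/= /halve_weight/= !addr0 -!UE.
  under eq_bigr do rewrite mulrBr mulrBl.
  rewrite sumrB !UE.
  have := U0 j.*2; have := U0 j.*2.+1.
  move: (U j.*2) (U j.*2.+1) => a b b0 a0; rewrite (max_r b0).
  by rewrite addr_maxl add0r subrK maxC.
- move=> i; rewrite /U (reindex_onto (fun c => (g, i, c)) snd)/=.
    by apply: eq_bigl => c; rewrite !eqxx.
  move=> [[g' i'] c] /= /andP[/eqP-> /eqP ii'].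
  by congr (_, _, _); apply/val_inj.
- move=> k mk; rewrite /U big_pred0// => -[[g' i] c] /=.
  by rewrite (ltn_eqF (leq_trans (ltn_ord i) mk)) andbF.
Qed.

End max_tree.

(** * Networks for weighted sums of hat functions, with their sizes *)

Section hat_network.
Variables (R : realType) (Y : finType) (a : Y -> R).
Hypothesis Y0 : (0 < #|Y|)%N.

(** The groups [(y, true)] and [(y, false)] carry the two maxima in the hat function of [y]. *)
Let hat_sum (M : Y * bool -> R) : R :=
  \sum_y a y * Num.max 0 (1 - \sum_s M (y, s)).

(* The value of an item is the sum of the outputs of its neurons, which C
   indexes: one neuron after the first layer, two later. *)
Let hat_max (m : nat) (C : finType) (v : Y * bool * 'I_m * C -> R) : R :=
  hat_sum (fun g => \big[Num.max/0]_i \sum_c v (g, i, c)).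

(** A maximum over one nonnegative item is the item itself, so one layer suffices; each [y] costs
    [2 * #|C|] weights, a bias and an output weight. *)
Lemma realizes_hat_sum (C : finType) :
  realizes (@hat_max 1 C) #|Y| 1 (#|Y| * (2 * #|C| + 2)).
Proof.
pose W (y : Y) (p : Y * bool * 'I_1 * C) : R := - (p.1.1.1 == y)%:R.
pose h (p : Y * bool * 'I_1 * C) := (p.1.1.1, p).
have hW y p : W y p != 0 -> exists t, h t = (y, p).
  by rewrite oppr_eq0 pnatr_eq0 eqb0 negbK => /eqP <-; exists p.
have hb (y : Y) : 1 != 0 :> R -> exists t, id t = y by exists y.
have := realizes_hidden Y0 hW hb (realizes_output a).
rewrite !card_prod card_bool card_ord maxn0 => rF.
apply: (realizes_le rF) => //; last by lia.
move=> v v0; apply: eq_bigr => y _; congr (_ * Num.max 0 _).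
rewrite addrC; congr (1 + _); rewrite -sumrN.
under [RHS]eq_bigr => s _.
  rewrite big_ord_recl big_ord0 max_l ?sumr_ge0// -sumrN; over.
rewrite pair_big/=.
rewrite (bigID (fun p : Y * bool * 'I_1 * C => p.1.1.1 == y))/=.
rewrite [X in _ + X]big1.
  rewrite addr0 (reindex_onto (fun q : bool * C => ((y, q.1), ord0, q.2))
    (fun p => (p.1.1.2, p.2)))/=.
    apply: eq_big => [[s c]|[s c] _]; first by rewrite !eqxx.
    by rewrite /W/= eqxx mulN1r.
  by move=> [[[y' s] i] c] /= /eqP->; rewrite (ord1 i).
by move=> p /negPf py; rewrite /W py oppr0 mul0r.
Qed.

(** Halving costs [4 * (m + m./2)] parameters per [y]. The slope 16 absorbs this for all [m >= 2],
    with equality at [m = 3]; the 6 is the final layer with two neurons per item. *)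
Lemma realizes_hat_tree (k m : nat) : (0 < m)%N -> (m <= 2 ^ k)%N ->
  realizes (@hat_max m bool) (4 * m * #|Y|) k.+1 (#|Y| * (16 * (m - 1) + 6)).
Proof.
elim: k m => [|k IH] m m0 mk.
  have -> : m = 1%N by lia.
  apply: (realizes_le (@realizes_hat_sum bool)) => //; rewrite ?card_bool; nia.
(* A single item must bypass halving, which would leave one item again and exceed the count. *)
have [m1|m1] := leqP m 1.
  have -> : m = 1%N by lia.
  apply: (realizes_le (@realizes_hat_sum bool)) => //; rewrite ?card_bool; nia.
have um0 : (0 < uphalf m)%N by rewrite uphalf_gt0.
have umk : (uphalf m <= 2 ^ k)%N.
  by rewrite leq_uphalf_double -mul2n -expnS.
have G0 : (0 < #|{: Y * bool}|)%N by rewrite card_prod card_bool muln_gt0 Y0.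
have rH := @realizes_halve R _ bool _ _ _ _ _ G0 m0 (IH _ um0 umk).
apply: (realizes_le rH) => //.
- have ule : (uphalf m <= m)%N by lia.
  by rewrite card_prod card_bool geq_max; apply/andP; split; nia.
- rewrite card_prod !card_bool.
  have -> : (#|Y| * 2 * (m + m./2) * 2 + #|Y| * (16 * (uphalf m - 1) + 6) =
     #|Y| * (4 * (m + m./2) + (16 * (uphalf m - 1) + 6)))%N by ring.
  by rewrite leq_mul2l; apply/orP; right; lia.
Qed.

(** The first halving is done apart from the tree: its items are single neurons, which halves its
    number of weights. *)
Lemma realizes_hat_max (d : nat) : (0 < d)%N ->
  realizes (@hat_max d unit) (4 * d * #|Y|) (up_log 2 d).+1 (12 * d * #|Y|).
Proof.
move=> d0; have [d1|d1] := leqP d 1.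
  have -> : d = 1%N by lia.
  apply: (realizes_le (@realizes_hat_sum unit)) => //;
    rewrite ?card_unit ?up_log1; lia.
have um0 : (0 < uphalf d)%N by rewrite uphalf_gt0.
have [k dk] : exists k, up_log 2 d = k.+1.
  by exists (up_log 2 d).-1; rewrite prednK// up_log_gt0.
have umk : (uphalf d <= 2 ^ k)%N.
  by rewrite leq_uphalf_double -mul2n -expnS -dk up_logP.
have G0 : (0 < #|{: Y * bool}|)%N by rewrite card_prod card_bool muln_gt0 Y0.
have rT := realizes_hat_tree um0 umk.
have rH := @realizes_halve R _ unit _ _ _ _ _ G0 d0 rT.
apply: (realizes_le rH) => //.
- have ule : (uphalf d <= d)%N by lia.
  by rewrite card_prod card_bool geq_max; apply/andP; split; nia.
- by rewrite dk.
- rewrite card_prod !card_bool card_unit muln1.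
  have -> : (#|Y| * 2 * (d + d./2) + #|Y| * (16 * (uphalf d - 1) + 6) =
     #|Y| * (2 * (d + d./2) + (16 * (uphalf d - 1) + 6)))%N by ring.
  by rewrite [leqRHS]mulnC leq_mul2l; apply/orP; right; lia.
Qed.

(** Each of the [2 * d * #|Y|] neurons of the first layer reads one coordinate, with one weight and
    one bias: this adds [4 * d * #|Y|] parameters to the 12 of [realizes_hat_max]. *)
Lemma realizes_hat (d : nat) (c : R) (b : Y -> 'I_d -> R) : (0 < d)%N ->
  realizes (fun x : 'I_d -> R => \sum_y a y * Num.max 0
      (1 - (\big[Num.max/0]_i Num.max 0 (c * x i - b y i) +
            \big[Num.max/0]_i Num.max 0 (b y i - c * x i))))
    (4 * d * #|Y|) (up_log 2 d).+2 (16 * d * #|Y|).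
Proof.
move=> d0.
pose J : finType := (Y * bool * 'I_d * unit)%type.
have J0 : (0 < #|J|)%N.
  by rewrite !card_prod card_bool card_unit card_ord !muln_gt0 Y0 d0.
pose sg (s : bool) : R := if s then 1 else -1.
pose W (q : J) (i : 'I_d) : R := sg q.1.1.2 * c * (i == q.1.2)%:R.
pose B (q : J) : R := - (sg q.1.1.2 * b q.1.1.1 q.1.2).
pose h (q : J) := (q, q.1.2).
have hW q i : W q i != 0 -> exists t, h t = (q, i).
  by rewrite /W; have [->|] := eqVneq i q.1.2; [exists q|rewrite mulr0 eqxx].
have hB q : B q != 0 -> exists t : J, id t = q by exists q.
have := realizes_hidden J0 hW hB (realizes_hat_max d0).
move=> rF; apply: (realizes_le rF) => //.
- move=> x x0; rewrite /hat_max /hat_sum; apply: eq_bigr => y _.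
  congr (_ * Num.max 0 (1 - _)); rewrite big_bool/=.
  have E s i : \sum_(u : unit) Num.max 0
      (\sum_i0 W (y, s, i, u) i0 * x i0 + B (y, s, i, u)) =
      Num.max 0 (sg s * (c * x i - b y i)).
    rewrite (big_pred1 tt) => [|[]//]; congr (Num.max 0 _).
    rewrite (bigD1 i)//= big1 => [|j /negPf ij]; last first.
      by rewrite /W ij mulr0 mul0r.
    by rewrite /W /B /= eqxx mulr1; ring.
  by congr (_ + _); apply: eq_bigr => i _; rewrite E /sg ?mul1r ?mulN1r ?opprB.
- by rewrite !card_prod card_bool card_unit card_ord; lia.
- by rewrite !card_prod card_bool card_unit card_ord; lia.
Qed.

End hat_network.

(** * Finite averages *)

Section quadrature.
Variable R : realType.

(** The left Riemann sum of [g] on the partition [a :: s]. *)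
Fixpoint left_sum (g : R -> R) (a : R) (s : seq R) : R :=
  if s is b :: s' then (b - a) * g a + left_sum g b s' else 0.

(** As [c] is a partition point, no cell straddles it and the sum telescopes up to [c]. *)
Lemma left_sum_indicator (c a : R) (s : seq R) :
  path <=%R a s -> c \in a :: s ->
  left_sum (fun t => (t < c)%R%:R) a s = c - a.
Proof.
elim: s a => [|b s IH] a /=.
  by rewrite mem_seq1 => _ /eqP->; rewrite subrr.
move=> /andP[ab pbs]; rewrite inE => /orP[/eqP->|cs].
  rewrite ltxx mulr0 add0r subrr.
  elim: s b ab pbs {IH} => //= e s IH b ab /andP[be pes].
  by rewrite ltNge ab mulr0 add0r IH// (le_trans ab).
rewrite IH//; have bc : b <= c.
  move: cs; rewrite inE => /orP[/eqP->//|cs'].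
  by move: pbs; rewrite (path_sortedE le_trans) => /andP[/allP/(_ c cs')].
have [ac|ca] := ltP a c; first by rewrite mulr1; ring.
have <- : c = b by apply/le_anti; rewrite bc (le_trans ca ab).
rewrite mulr0 add0r subrr; apply/esym/eqP.
by rewrite subr_eq0 eq_le ca (le_trans ab bc).
Qed.

Lemma left_sumE (g : R -> R) (a : R) (s : seq R) :
  left_sum g a s =
  \sum_(k < size s) (nth 0 (a :: s) k.+1 - nth 0 (a :: s) k) *
                    g (nth 0 (a :: s) k).
Proof.
elim: s a => [|b s IH] a /=; first by rewrite big_ord0.
by rewrite big_ord_recl/= IH.
Qed.

(* A substitute for integrating over theta in [0, 1): the average over the nodes
   is exact on all intervals whose end points are among finitely many
   prescribed breakpoints. *)
Lemma quadrature (B : seq R) :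
  exists (N : nat) (p t : 'I_N -> R),
    [/\ forall k, 0 <= p k, forall k, 0 <= t k < 1, \sum_k p k = 1 &
      forall c, c \in B -> 0 <= c <= 1 -> \sum_k p k * (t k < c)%R%:R = c].
Proof.
(* Adding 1 as a breakpoint makes total mass 1 an instance of exactness. *)
pose s := sort <=%R [seq c <- 1 :: B | 0 <= c <= 1].
have ps : path <=%R 0 s.
  rewrite (path_sortedE le_trans) (sort_sorted le_total) andbT.
  by rewrite all_sort; apply/allP => c; rewrite mem_filter => /andP[/andP[]].
have mems c : (c \in s) = (c \in 1 :: B) && (0 <= c <= 1).
  by rewrite mem_sort mem_filter andbC.
pose x k := nth 0 (0 :: s) k.
have x01 k : 0 <= x k <= 1.
  have [ks|sk] := ltnP k (size (0 :: s)); last first.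
    by rewrite /x nth_default// lexx ler01.
  have : x k \in 0 :: s by exact: mem_nth.
  by rewrite inE => /orP[/eqP->|]; rewrite ?lexx ?ler01// mems => /andP[].
have xle (k : 'I_(size s)) : x k <= x k.+1.
  by have /(pathP 0)/(_ k (ltn_ord k)) := ps.
have exact c : c \in 1 :: B -> 0 <= c <= 1 ->
    \sum_(k < size s) (x k.+1 - x k) * (x k < c)%R%:R = c.
  move=> cB c01; rewrite -(left_sumE (fun t => (t < c)%R%:R)).
  by rewrite left_sum_indicator ?subr0// inE mems cB c01 orbT.
(* Weights are cell lengths. A node at 1 lies outside [[0, 1)]; it gets weight 0 and the dummy
   position 0. *)
exists (size s), (fun k => (x k.+1 - x k) * (x k < 1)%R%:R),
  (fun k => if x k < 1 then x k else 0); split.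
- by move=> k; rewrite mulr_ge0 ?ler0n// subr_ge0.
- move=> k; case: ltP => [xk|_]; last by rewrite lexx ltr01.
  by rewrite xk andbT; case/andP: (x01 k).
- by apply: exact; rewrite ?mem_head// ler01 lexx.
- move=> c cB c01; rewrite -[RHS](exact c)//; last by rewrite inE cB orbT.
  apply: eq_bigr => k _; case: ltP => [_|xk]; first by rewrite mulr1.
  rewrite mulr0 mul0r ltNge.
  by case/andP: c01 => _ c1; rewrite (le_trans c1 xk)// mulr0.
Qed.

Lemma concave_Jensen (D : R) (w : R -> R) (N : nat) (p z : 'I_N -> R) :
  concave_on `[0, D] w ->
  (forall k, 0 <= p k) -> (forall k, 0 <= z k <= D) -> \sum_k p k = 1 ->
  \sum_k p k * w (z k) <= w (\sum_k p k * z k).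
Proof.
move=> wc p0 zD p1.
(* The induction runs over weights of arbitrary total mass [P]; the bounds on [S] keep [S / P] in
   the domain of [w]. *)
suff [_] : let P := \sum_k p k in let S := \sum_k p k * z k in
    0 <= S <= P * D /\ (0 < P -> \sum_k p k * w (z k) <= P * w (S / P)).
  by rewrite p1 mul1r divr1; apply.
elim: N p z p0 zD {p1} => [|N IH] p z p0 zD /=.
  by rewrite !big_ord0 mul0r lexx ltxx.
rewrite !big_ord_recr/=.
have := IH (fun k => p (widen_ord (leqnSn N) k))
  (fun k => z (widen_ord (leqnSn N) k)) (fun=> p0 _) (fun=> zD _).
have P0 : 0 <= \sum_(k < N) p (widen_ord (leqnSn N) k) by exact: sumr_ge0.
have Pw : \sum_(k < N) p (widen_ord (leqnSn N) k) = 0 -> forall g : R -> R,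
    \sum_(k < N) p (widen_ord (leqnSn N) k) *
      g (z (widen_ord (leqnSn N) k)) = 0.
  move=> /eqP; rewrite psumr_eq0// => /allP Pz g.
  by rewrite big1// => k _; rewrite (eqP (Pz k (mem_index_enum _))) mul0r.
move: Pw; move: P0; move: (\sum_(k < N) p _) => P.
set S := \sum_(k < N) _ * z _; set V := \sum_(k < N) _ * w _.
move: (p ord_max) (z ord_max) (p0 ord_max) (zD ord_max) => q y q0 /andP[y0 yD].
move=> P0 Pw [/andP[S0 SD] VS]; split; first by nra.
move=> Pq0.
(* If [P = 0], all earlier terms vanish and only the last one is left. Otherwise concavity is
   applied between [S / P] and [y]. *)
have [P_eq0|P_neq0] := eqVneq P 0.
  have V0 : V = 0 := Pw P_eq0 w.
  have Sz : S = 0 := Pw P_eq0 id.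
  move: Pq0; rewrite V0 Sz P_eq0 !add0r => q_gt0.
  by rewrite [q * y]mulrC mulfK// gt_eqF.
have P_gt0 : 0 < P by rewrite lt0r P_neq0.
apply: le_trans (lerD (VS P_gt0) (lexx _)) _.
have := wc (S / P) y _ _ (P / (P + q)).
rewrite !in_itv/= y0 yD divr_ge0//= ler_pdivrMr// [D * P]mulrC SD.
move=> /(_ isT isT).
rewrite divr_ge0 ?(ltW Pq0)//= ler_pdivrMr// mul1r lerDl q0 => /(_ isT).
have -> : P / (P + q) * (S / P) + (1 - P / (P + q)) * y = (S + q * y) / (P + q).
  by field; rewrite P_neq0 gt_eqF.
move=> wle; rewrite -(ler_pM2l Pq0) in wle; apply: le_trans wle.
have -> // : (P + q) * (P / (P + q) * w (S / P) + (1 - P / (P + q)) * w y) =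
    P * w (S / P) + q * w y.
by field; rewrite gt_eqF.
Qed.

End quadrature.

(** * Kuhn interpolation *)

Section interpolation.
Variables (R : realType) (d n : nat).
Hypothesis n0 : (0 < n)%N.

Definition grid_index : finType := {ffun 'I_d -> 'I_n.+1}.

Definition grid_node (y : grid_index) : d.-tuple R :=
  [tuple (y i)%:R / n%:R | i < d].

Definition excess (x : d.-tuple R) (y : grid_index) : R :=
  \big[Num.max/0]_i Num.max 0 (n%:R * tnth x i - (y i)%:R).

Definition deficit (x : d.-tuple R) (y : grid_index) : R :=
  \big[Num.max/0]_i Num.max 0 ((y i)%:R - n%:R * tnth x i).

Definition kuhn_hat (x : d.-tuple R) (y : grid_index) : R :=
  Num.max 0 (1 - (excess x y + deficit x y)).

Definition kuhn_interpolant (f : d.-tuple R -> R) (x : d.-tuple R) : R :=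
  \sum_y f (grid_node y) * kuhn_hat x y.

Definition grid_round (x : d.-tuple R) (theta : R) : grid_index :=
  [ffun i => inord (Num.truncn (n%:R * tnth x i + theta))].

Definition frac (s : R) : R := s - (Num.truncn s)%:R.

(** The shifts at which rounding to some node [y] starts or stops, and those at which a coordinate
    switches from rounding down to rounding up. *)
Definition breakpoints (x : d.-tuple R) : seq R :=
  [seq deficit x y | y : grid_index] ++ [seq 1 - excess x y | y : grid_index] ++
  [seq 1 - frac (n%:R * tnth x i) | i : 'I_d].

Let nR0 : 0 < n%:R :> R. Proof. by rewrite ltr0n. Qed.

Lemma grid_node_cube (y : grid_index) : unit_cube R d (grid_node y).
Proof.
move=> i; rewrite tnth_mktuple divr_ge0 ?ler0n//= ler_pdivrMr// mul1r ler_nat.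
by rewrite -ltnS ltn_ord.
Qed.

Lemma unit_grid_cube (x : d.-tuple R) : unit_grid n x -> unit_cube R d x.
Proof.
move=> gx i; have [k kn ->] := gx i.
by rewrite divr_ge0 ?ler0n//= ler_pdivrMr// mul1r ler_nat.
Qed.

Lemma l1_dist_cube (x x' : d.-tuple R) :
  unit_cube R d x -> unit_cube R d x' -> 0 <= l1_dist x x' <= d%:R.
Proof.
move=> cx cx'; rewrite sumr_ge0//= -[X in _ <= X%:R]card_ord -sumr_const.
apply: ler_sum => i _; have := cx i; have := cx' i; rewrite ler_norml; lra.
Qed.

Lemma frac_itv (s : R) : 0 <= s -> 0 <= frac s < 1.
Proof. by move=> /truncn_itv; rewrite /frac -natr1; lra. Qed.

Lemma truncn_shift (s theta : R) : 0 <= s -> 0 <= theta < 1 ->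
  (Num.truncn (s + theta))%:R =
  (Num.truncn s)%:R + (1 - frac s <= theta)%R%:R :> R.
Proof.
move=> s0 /andP[t0 t1]; have /andP[q0 q1] := frac_itv s0.
have sE : s = (Num.truncn s)%:R + frac s by rewrite /frac addrC subrK.
have -> : Num.truncn (s + theta) = (Num.truncn s + (1 - frac s <= theta)%R)%N.
  apply: truncn_def; rewrite -addn1 !natrD.
  by case: (leP (1 - frac s) theta) => /= ?; apply/andP; split; lra.
by rewrite natrD.
Qed.

(** On the cube [n x_i + theta < n + 1], so [inord] never falls back to its default. *)
Lemma grid_roundE (x : d.-tuple R) (theta : R) (i : 'I_d) :
  unit_cube R d x -> 0 <= theta < 1 ->
  (grid_round x theta i : nat) = Num.truncn (n%:R * tnth x i + theta).
Proof.
move=> cx /andP[t0 t1]; have /andP[x0 x1] := cx i.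
rewrite ffunE inordK// truncn_lt_nat; last first.
  by rewrite addr_ge0// mulr_ge0 ?ler0n.
by rewrite -natr1; have := ler_wpM2l (ltW nR0) x1; lra.
Qed.

(** Coordinate [i] rounds to [y_i] iff [y_i - n x_i <= theta < 1 - (n x_i - y_i)]; intersecting
    these intervals with [[0, 1)] gives the two maxima. *)
Lemma grid_round_eq (x : d.-tuple R) (y : grid_index) (theta : R) :
  unit_cube R d x -> 0 <= theta < 1 ->
  (grid_round x theta == y) = (deficit x y <= theta < 1 - excess x y).
Proof.
move=> cx t01; have /andP[t0 t1] := t01.
have s0 i : 0 <= n%:R * tnth x i + theta.
  by have /andP[x0 _] := cx i; rewrite addr_ge0// mulr_ge0 ?ler0n.
have -> : (theta < 1 - excess x y) = (excess x y < 1 - theta).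
  by rewrite !ltrBrDl addrC.
apply/eqP/andP => [<-|[/bigmax_leP[_ defle] /bigmax_ltP[_ exclt]]].
  split.
    apply/bigmax_leP; split=> // i _; rewrite ge_max t0 grid_roundE//.
    by have := truncn_itv (s0 i); lra.
  apply/bigmax_ltP; split=> [|i _]; first lra.
  rewrite gt_max grid_roundE//; have := truncn_itv (s0 i); rewrite -natr1; lra.
apply/ffunP => i; apply/val_inj; rewrite /= grid_roundE//; apply: truncn_def.
have := defle i isT; have := exclt i isT; rewrite ge_max gt_max -natr1; lra.
Qed.

(** * Expectations over the random shift *)

Section expectation.
Variables (N : nat) (p t : 'I_N -> R) (x : d.-tuple R).
Hypotheses (t01 : forall k, 0 <= t k < 1) (p1 : \sum_k p k = 1).
Hypothesis cx : unit_cube R d x.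
Hypothesis exact : forall c, c \in breakpoints x -> 0 <= c <= 1 ->
  \sum_k p k * (t k < c)%R%:R = c.

(** The hat is the length of the interval of [grid_round_eq], obtained as a difference of two exact
    averages, or 0 if the interval is empty. *)
Lemma expect_round_eq (y : grid_index) :
  \sum_k p k * (grid_round x (t k) == y)%:R = kuhn_hat x y.
Proof.
have A0 : 0 <= deficit x y by exact: bigmax_ge_id.
have B0 : 0 <= excess x y by exact: bigmax_ge_id.
under eq_bigr do rewrite grid_round_eq//.
rewrite /kuhn_hat opprD addrA.
have Abp : deficit x y \in breakpoints x by rewrite mem_cat map_f ?mem_enum.
have Bbp : 1 - excess x y \in breakpoints x.
  by rewrite !mem_cat (map_f (fun y => 1 - excess x y)) ?mem_enum ?orbT.
have [AB|BA] := ltP (deficit x y) (1 - excess x y).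
  rewrite max_r; last by rewrite subr_ge0 ltW.
  rewrite -[in RHS](exact Abp); last lra.
  rewrite -[in RHS](exact Bbp); last lra.
  rewrite -sumrB; apply: eq_bigr => k _; rewrite -mulrBr; congr (_ * _).
  case: (leP (deficit x y)) => Ak; case: (ltP _ (1 - excess x y)) => Bk /=;
    rewrite ?subrr ?subr0//.
  by have := lt_trans Ak AB; rewrite ltNge Bk.
rewrite max_l ?subr_le0// big1// => k _.
case: (leP (deficit x y)) => Ak /=; last by rewrite mulr0.
by rewrite ltNge (le_trans BA Ak) mulr0.
Qed.

Lemma expect_round (g : grid_index -> R) :
  \sum_y g y * kuhn_hat x y = \sum_k p k * g (grid_round x (t k)).
Proof.
under eq_bigr do rewrite -expect_round_eq mulr_sumr.
rewrite exchange_big/=; apply: eq_bigr => k _.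
rewrite (bigD1 (grid_round x (t k)))//= big1 => [|y /negPf yk].
  by rewrite eqxx mulr1 addr0 mulrC.
by rewrite eq_sym yk !mulr0.
Qed.

Lemma expect_frac (i : 'I_d) :
  \sum_k p k * (t k < 1 - frac (n%:R * tnth x i))%R%:R =
  1 - frac (n%:R * tnth x i).
Proof.
have x0 : 0 <= n%:R * tnth x i by have /andP[? _] := cx i; rewrite mulr_ge0.
apply: exact; last by have := frac_itv x0; lra.
rewrite !mem_cat; apply/orP; right; apply/orP; right.
by rewrite (map_f (fun i => 1 - frac (n%:R * tnth x i))) ?mem_enum.
Qed.

(** Rounding is unbiased: the coordinate is its floor plus one with probability equal to the
    fractional part, and its floor otherwise. *)
Lemma expect_coordinate (i : 'I_d) :
  \sum_k p k * (grid_round x (t k) i)%:R = n%:R * tnth x i.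
Proof.
have x0 : 0 <= n%:R * tnth x i by have /andP[? _] := cx i; rewrite mulr_ge0.
transitivity (\sum_k (((Num.truncn (n%:R * tnth x i))%:R + 1) * p k -
    p k * (t k < 1 - frac (n%:R * tnth x i))%R%:R)).
  apply: eq_bigr => k _.
  by rewrite grid_roundE// truncn_shift// leNgt; case: ltP => _ /=; ring.
rewrite sumrB -mulr_sumr p1 expect_frac mulr1 /frac; ring.
Qed.

(** Rounding down has probability [1 - q] and distance [q / n]; rounding up has probability [q] and
    distance [(1 - q) / n]. *)
Lemma expect_distance (i : 'I_d) (q := frac (n%:R * tnth x i)) :
  \sum_k p k * `|tnth x i - (grid_round x (t k) i)%:R / n%:R| =
  2 * q * (1 - q) / n%:R.
Proof.
have x0 : 0 <= n%:R * tnth x i by have /andP[? _] := cx i; rewrite mulr_ge0.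
have /andP[q0 q1] := frac_itv x0; rewrite -/q in q0 q1.
transitivity (\sum_k ((1 - q) / n%:R * p k +
    (2 * q - 1) / n%:R * (p k * (t k < 1 - q)%R%:R))).
  apply: eq_bigr => k _; rewrite grid_roundE// truncn_shift// -/q.
  have xE : tnth x i = ((Num.truncn (n%:R * tnth x i))%:R + q) / n%:R.
    by rewrite /q /frac addrC subrK mulrAC divff ?mul1r// gt_eqF.
  rewrite [X in X - _]xE -mulrBl normrM normfV normr_nat [_ + q]addrC addrKA.
  rewrite leNgt; case: ltP => _ /=; rewrite ?subr0 ?mulr0 ?mulr1.
    by rewrite ger0_norm//; field; rewrite gt_eqF.
  by rewrite ltr0_norm ?subr_lt0//; field; rewrite gt_eqF.
rewrite big_split/= -!mulr_sumr p1 expect_frac -/q.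
by field; rewrite gt_eqF.
Qed.

Lemma expect_l1_dist :
  \sum_k p k * l1_dist x (grid_node (grid_round x (t k))) <= d%:R / (2 * n%:R).
Proof.
under eq_bigr do rewrite mulr_sumr.
rewrite exchange_big/=.
apply: (@le_trans _ _ (\sum_(i < d) (2 * n%:R)^-1)); last first.
  by rewrite sumr_const card_ord -[leLHS]mulr_natl.
apply: ler_sum => i _; under eq_bigr do rewrite tnth_mktuple.
rewrite expect_distance invfM ler_pM2r ?invr_gt0//.
(* This square gives [q (1 - q) <= 1 / 4]. *)
have := sqr_ge0 (2 * frac (n%:R * tnth x i) - 1); nra.
Qed.

End expectation.

Lemma expect_l1_dist_round (N : nat) (p t : 'I_N -> R) (x x' : d.-tuple R) :
  (forall k, 0 <= t k < 1) -> \sum_k p k = 1 ->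
  unit_cube R d x -> unit_cube R d x' ->
  (forall c, c \in breakpoints x ++ breakpoints x' -> 0 <= c <= 1 ->
     \sum_k p k * (t k < c)%R%:R = c) ->
  \sum_k p k * l1_dist (grid_node (grid_round x (t k)))
                       (grid_node (grid_round x' (t k))) =
  l1_dist x x'.
Proof.
move=> t01 p1.
(* For ordered coordinates the absolute value opens with the same sign for every shift, and
   unbiasedness applies. The points are generalized so that they can be swapped. *)
have mono i z z' : unit_cube R d z -> unit_cube R d z' ->
    (forall c, c \in breakpoints z ++ breakpoints z' -> 0 <= c <= 1 ->
       \sum_k p k * (t k < c)%R%:R = c) ->
    tnth z i <= tnth z' i ->
    \sum_k p k * `|(grid_round z (t k) i)%:R / n%:R -
                    (grid_round z' (t k) i)%:R / n%:R| =
    `|tnth z i - tnth z' i|.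
  move=> cz cz' exact zz'.
  rewrite distrC ger0_norm ?subr_ge0//.
  have Ez := @expect_coordinate _ p t z t01 p1 cz _ i.
  have Ez' := @expect_coordinate _ p t z' t01 p1 cz' _ i.
  transitivity ((n%:R * tnth z' i - n%:R * tnth z i) / n%:R); last first.
    by field; rewrite gt_eqF.
  rewrite -Ez; last by move=> c cB; apply: exact; rewrite mem_cat cB.
  rewrite -Ez'; last by move=> c cB; apply: exact; rewrite mem_cat cB orbT.
  rewrite -sumrB mulr_suml; apply: eq_bigr => k _.
  rewrite -mulrBl normrM normfV normr_nat distrC ger0_norm ?mulrA ?mulrBr//.
  rewrite subr_ge0 ler_nat !grid_roundE//; apply: le_truncn.
  by rewrite lerD2r ler_pM2l.
move=> cx cx' exact; rewrite /l1_dist.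
under eq_bigr do rewrite mulr_sumr.
rewrite exchange_big/=; apply: eq_bigr => i _.
under eq_bigr do rewrite !tnth_mktuple.
have [xx'|/ltW x'x] := leP (tnth x i) (tnth x' i); first exact: mono.
rewrite distrC -mono//; first by under eq_bigr do rewrite distrC.
by move=> c; rewrite mem_cat orbC -mem_cat; exact: exact.
Qed.

(** * Regularity, error and exactness of the interpolant *)

Section modulus.
Variables (f : d.-tuple R -> R) (w : R -> R).
Hypothesis fw : modulus_of_regularity_of `[0, d%:R] w (unit_cube R d) f.

Let wconcave : concave_on `[0, d%:R] w. Proof. by case: fw => -[]. Qed.

Let fle (x x' : d.-tuple R) : unit_cube R d x -> unit_cube R d x' ->
  `|f x - f x'| <= w (l1_dist x x').
Proof. by case: fw => _ h cx cx'; apply: h; exact/mem_set. Qed.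

Lemma kuhn_interpolant_modulus :
  {in unit_cube R d &, forall x x',
    `|kuhn_interpolant f x - kuhn_interpolant f x'| <= w (l1_dist x x')}.
Proof.
move=> x x' /set_mem cx /set_mem cx'.
(* One quadrature serves both points, so that they are rounded with the same shifts. *)
have [N [p [t [p0 t01 p1 exact]]]] :=
  quadrature (breakpoints x ++ breakpoints x').
rewrite -(expect_l1_dist_round t01 p1 cx cx' exact).
rewrite /kuhn_interpolant (@expect_round _ p t x t01 cx); last first.
  by move=> c cB; apply: exact; rewrite mem_cat cB.
rewrite (@expect_round _ p t x' t01 cx'); last first.
  by move=> c cB; apply: exact; rewrite mem_cat cB orbT.
rewrite -sumrB; apply: le_trans (ler_norm_sum _ _ _) _.
apply: le_trans (concave_Jensen wconcave p0 _ p1) => [|k].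
  apply: ler_sum => k _; rewrite -mulrBr normrM ger0_norm// ler_wpM2l//.
  exact: fle (grid_node_cube _) (grid_node_cube _).
exact: l1_dist_cube (grid_node_cube _) (grid_node_cube _).
Qed.

Lemma kuhn_interpolant_error (x : d.-tuple R) : unit_cube R d x ->
  `|f x - kuhn_interpolant f x| <= w (d%:R / (2 * n%:R)).
Proof.
move=> cx.
have [N [p [t [p0 t01 p1 exact]]]] := quadrature (breakpoints x).
have dist01 k := l1_dist_cube cx (grid_node_cube (grid_round x (t k))).
rewrite /kuhn_interpolant (@expect_round _ p t x t01 cx exact).
rewrite -[f x]mul1r -[X in X * f x]p1 mulr_suml -sumrB.
apply: le_trans (ler_norm_sum _ _ _) _.
apply: (@le_trans _ _
  (\sum_k p k * w (l1_dist x (grid_node (grid_round x (t k)))))).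
  apply: ler_sum => k _; rewrite -mulrBr normrM ger0_norm// ler_wpM2l//.
  exact: fle cx (grid_node_cube _).
apply: le_trans (concave_Jensen wconcave p0 dist01 p1) _.
have dE := expect_l1_dist t01 p1 cx exact.
case: fw => -[_ _ wmono _] _; apply: wmono => //.
- rewrite in_itv/= sumr_ge0/= => [|k _]; last first.
    by rewrite mulr_ge0//; case/andP: (dist01 k).
  rewrite -[d%:R]mul1r -[X in _ <= X * _]p1 mulr_suml; apply: ler_sum => k _.
  by rewrite ler_wpM2l//; case/andP: (dist01 k).
- rewrite in_itv/= divr_ge0/= ?mulr_ge0 ?ler0n//.
  rewrite ler_pdivrMr ?mulr_gt0//.
  by rewrite ler_peMr ?ler0n// -natrM ler1n muln_gt0 n0.
Qed.

(** At a grid point [n x_i] is an integer, so every shift in [[0, 1)] rounds the point to itself. *)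
Lemma kuhn_interpolant_grid (x : d.-tuple R) : unit_grid n x ->
  kuhn_interpolant f x = f x.
Proof.
move=> gx.
have cx := unit_grid_cube gx.
have [N [p [t [p0 t01 p1 exact]]]] := quadrature (breakpoints x).
rewrite /kuhn_interpolant (@expect_round _ p t x t01 cx exact).
rewrite -[RHS]mul1r -[X in X * f x]p1 mulr_suml; apply: eq_bigr => k _.
congr (_ * f _); apply: eq_from_tnth => i; rewrite tnth_mktuple grid_roundE//.
have [j _ ->] := gx i.
rewrite mulrCA divff ?gt_eqF// mulr1.
suff -> : Num.truncn (j%:R + t k) = j by [].
by apply: truncn_def; rewrite -natr1; have := t01 k; lra.
Qed.

End modulus.

End interpolation.

Theorem theorem4p1 (R : realType) (d : nat) (hd : (0 < d)%N)
    (f : d.-tuple R -> R) (w : R -> R)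
    (hw : modulus_of_regularity_of `[0, d%:R] w (unit_cube R d) f)
    (n : nat) (hn : (0 < n)%N) :
  exists N : mlp R 1 d,
    [/\ (mlp_width N <= 8 * d * (n + 1) ^ d)%N,
        (mlp_depth N <= up_log 2 d + 4)%N &
        (mlp_params N <= 16 * d * (n + 1) ^ d)%N] /\
    [/\ (Linfty_norm (unit_cube R d) (f \- mlp_fun N)%R
          <= (w (d%:R / (2 * n%:R)))%:E)%E,
        forall x, unit_grid n x -> f x = mlp_fun N x &
        modulus_of_regularity_of `[0, d%:R] w (unit_cube R d) (mlp_fun N)].
Proof.
have cardY : #|grid_index d n| = ((n + 1) ^ d)%N.
  by rewrite card_ffun !card_ord addn1.
have Y0 : (0 < #|grid_index d n|)%N by rewrite cardY expn_gt0 addn1.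
have idd : bijective (id : 'I_d -> 'I_d) by exists id.
have [N [Nw Nd Np NF]] := realizes_hat (fun y => f (grid_node R y)) Y0 n%:R
  (fun y i => (y i)%:R) hd idd.
have cubeE x : unit_cube R d x -> mlp_fun N x = kuhn_interpolant n f x.
  by move=> cx; rewrite /mlp_fun NF// => i; case/andP: (cx i).
exists N; split; split.
- apply: leq_trans Nw _; rewrite cardY; lia.
- lia.
- by rewrite -cardY.
- apply: ereal_inf_lbound; exists (w (d%:R / (2 * n%:R))) => //; split.
    (* The error bound at any point of the cube, here the origin, shows that the constant is
       nonnegative. *)
    have c0 := @grid_node_cube R d n hn [ffun=> ord0].
    exact: le_trans (normr_ge0 _) (kuhn_interpolant_error hn hw c0).
  apply: aeW => x cx.
  change (`|f x - mlp_fun N x| <= w (d%:R / (2 * n%:R))).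
  by rewrite cubeE//; exact: kuhn_interpolant_error.
- move=> x gx; have cx := unit_grid_cube hn gx.
  by rewrite cubeE// (kuhn_interpolant_grid hn).
- have [wm _] := hw; split=> // x x' cx cx'; rewrite !cubeE; try exact/set_mem.
  exact: kuhn_interpolant_modulus.
Qed.
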